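(* Assume impermeable wall boundary conditions $\int_{\partial\Omega}\mathbf v\cdot\mathbf n\,\mathrm ds=0$, i.e. at the discrete level $\sum_{p\in\partial\Omega}\mathbf v_p^*\cdot l_{pb}\mathbf n_{pb}=0$ (sum over boundary nodes). Consider a solution $(\tau_c,\mathbf v_c,S_c)_c$, $(\mathbf x_p)_p$ of the semi-discrete scheme: for every cell $c$, $$m_c\frac{\mathrm d\tau_c}{\mathrm dt}-\sum_{p\in\mathcal P(c)}l_{pc}\mathbf n_{pc}\cdot(\mathbf v_p^*-\mathbf v_c)=0,$$ $$m_c\frac{\mathrm d\mathbf v_c}{\mathrm dt}+\sum_{p\in\mathcal P(c)}l_{pc}\mathbf n_{pc}\,(p_{pc}^*-p_c)=\mathbf 0,$$ $$m_c\frac{\mathrm dS_c}{\mathrm dt}=\sum_{p\in\mathcal P(c)}\Pi_{pc},\qquad \Pi_{pc}=\frac1{\theta_c}(\mathbf v_c-\mathbf v_p^* )\cdot\mathbf M_{pc}(\mathbf v_c-\mathbf v_p^* )\ge0,$$ and $\frac{\mathrm d\mathbf x_p}{\mathrm dt}=\mathbf v_p^*$ for every node $p$, where the sub-cell force, denoted $l_{pc}\mathbf n_{pc}\,p_{pc}^*$, is defined by $$l_{pc}\mathbf n_{pc}\,p_{pc}^*=l_{pc}\mathbf n_{pc}\,p_c-\mathbf M_{pc}(\mathbf v_p^*-\mathbf v_c),$$ and the nodal velocity $\mathbf v_p^*$ is the solution of the linear system $$\mathbf M_p\mathbf v_p^*=\sum_{c\in\mathcal C(p)}\big(l_{pc}\mathbf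 n_{pc}\,p_c+\mathbf M_{pc}\mathbf v_c\big),\qquad \mathbf M_p=\sum_{c\in\mathcal C(p)}\mathbf M_{pc}.$$ Then the scheme is nonlinearly stable in the energy norm, in the sense that $$\int_\Omega\rho\,\frac{\mathrm dE}{\mathrm dt}\,\mathrm d\mathbf x=0,\qquad\text{that is,}\qquad\sum_c m_c\frac{\mathrm dE_c}{\mathrm dt}=0$$ at all times, where $E_c=\varepsilon(\tau_c,S_c)+\tfrac12|\mathbf v_c|^2$.
   Context: Mesh: a bounded moving domain $\Omega(t)\subset\mathbb R^2$ is covered by a conforming mesh of finitely many non-overlapping, non-degenerate triangles $\omega_c(t)$ (cells, indexed by $c$), with vertices (nodes) at positions $\mathbf x_p(t)$; the mesh topology is fixed in time. $\mathcal P(c)$ is the set of vertices of cell $c$, and $\mathcal C(p)$ the set of cells sharing node $p$. For $p\in\mathcal P(c)$, the two edges of $\omega_c$ meeting at $p$ have half-lengths $l_{pc}^-,l_{pc}^+$ (distances from $\mathbf x_p$ to the edge midpoints) and unit normals $\mathbf n_{pc}^-,\mathbf n_{pc}^+$ pointing outward from $\omega_c$; the corner vector is $l_{pc}\mathbf n_{pc}=l_{pc}^+\mathbf n_{pc}^++l_{pc}^-\mathbf n_{pc}^-$. These satisfy $\sum_{p\in\mathcal P(c)}l_{pc}\mathbf n_{pc}=\mathbf 0$ for each cell, $\sum_{c\in\mathcal C(p)}l_{pc}\mathbf n_{pc}=\mathbf 0$ for each interior node, and $\sum_{c\in\mathcal C(p)}l_{pc}\mathbf n_{pc}=l_{pb}\mathbf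 n_{pb}$ for each boundary node, where $l_{pb}\mathbf n_{pb}$ is the sum, over the two boundary edges meeting at $p$, of the half-length times the outward unit normal of $\Omega$. Unknowns: $\tau_c>0$ (specific volume), $\mathbf v_c\in\mathbb R^2$ (velocity), $S_c$ (specific entropy) are functions of time attached to each cell (mass averages); the density is $\rho_c=1/\tau_c$, and $m_c=|\omega_c(t)|/\tau_c(t)>0$ is the cell mass, constant in time. All geometric quantities depend on time through the $\mathbf x_p$. Equation of state: the specific internal energy $\varepsilon=\varepsilon(\tau,S)$ is a given smooth convex function with $\partial^2\varepsilon/\partial\tau^2>0$; pressure and temperature are $p=-\partial\varepsilon/\partial\tau$ and $\theta=\partial\varepsilon/\partial S$, with $\theta>0$; the isentropic sound speed $a>0$ is given by $a^2/\tau^2=\partial^2\varepsilon/\partial\tau^2$; a subscript $c$ denotes evaluation at $(\tau_c,S_c)$. The specific total energy is $E=\varepsilon+\frac12|\mathbf v|^2$. Corner viscosity matrix (symmetric positive definite): $\mathbf M_{pc}=\frac{a_c}{\tau_c}\big(l_{pc}^-\,\mathbf n_{pc}^-\otimes\mathbf n_{pc}^-+l_{pc}^+\,\mathbf n_{pc}^+\otimes\mathbf n_{pc}^+\big)$. In the momentum equation, $l_{pc}\mathbf n_{pc}\,p_{pc}^*$ is a single symbol for the vector defined in the claim (it need not be parallel to $l_{pc}\mathbf n_{pc}$), so $l_{pc}\mathbf n_{pc}(p_{pc}^*-p_c)$ means $-\mathbf M_{pc}(\mathbf v_p^*-\mathbf v_c)$. *)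

(* Defs.v *)
From HB Require Import structures.
From mathcomp Require Import all_boot all_order all_algebra.
From mathcomp Require Import all_classical all_reals all_analysis.

Set Implicit Arguments.
Unset Strict Implicit.
Unset Printing Implicit Defensive.

Import Order.TTheory GRing.Theory Num.Theory.
Import numFieldNormedType.Exports.

Local Open Scope classical_set_scope.
Local Open Scope ring_scope.

Section Plane.
Variable R : realType.
Implicit Types u v : 'cV[R]_2.

Definition dot u v : R := \sum_(i < 2) u i 0 * v i 0.

(* The library norm `|u| on matrices is the sup norm, hence this definition. *)
Definition enorm u : R := Num.sqrt (dot u u).

(* Rotation by a quarter turn, (a, b) |-> (-b, a). *)
Definition perp u : 'cV[R]_2 := \col_(i < 2) (if i == 0 then - u 1 0 else u 0 0).

Definition tensor u v : 'M[R]_2 := u *m v^T.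

(* Lebesgue measure on the plane, column vectors being read as pairs. *)
Definition area (A : set 'cV[R]_2) : R :=
  fine ((@lebesgue_measure R \x @lebesgue_measure R)%E
          [set (w 0 0, w 1 0) | w in A]).

(* Closed convex hull of the points X p, p in A; empty when A is. *)
Definition hull (T : finType) (X : T -> 'cV[R]_2) (A : {set T}) :
    set 'cV[R]_2 :=
  [set z | exists w : T -> R,
     [/\ forall p, 0 <= w p, \sum_(p in A) w p = 1
       & z = \sum_(p in A) w p *: X p]].

End Plane.

(* The time-independent topology of a triangular mesh: [vertices c] is P(c). *)
Record mesh := Mesh {
  node : finType;
  cell : finType;
  vertices : cell -> {set node};
  card_vertices : forall c, #|vertices c| = 3%N;
  node_in_cell : forall p, exists c, p \in vertices c
}.
Arguments vertices {m} c.

Section Topology.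
Variable M : mesh.
Implicit Types (c : cell M) (p q : node M).

Definition cells_at p : {set cell M} := [set c | p \in vertices c]%SET.

(* Edges lying in exactly one cell: in a conforming mesh these are the edges
   contained in the boundary of the union of the cells. *)
Definition boundary_edge p q : bool :=
  (p != q) && (#|cells_at p :&: cells_at q| == 1%N).

Definition boundary_nodes : {set node M} :=
  [set p | [exists q, boundary_edge p q]]%SET.

End Topology.

Section Geometry.
Variables (R : realType) (M : mesh).
Variable X : node M -> 'cV[R]_2.
Implicit Types (c d : cell M) (p q r : node M).

Definition triangle c : set 'cV[R]_2 := hull X (vertices c).

Definition domain : set 'cV[R]_2 := (\bigcup_(c in setT) triangle c)°.

(* Vertex positions X form a conforming triangulation of [domain], which is
   then automatically open and bounded. *)
Record triangulation : Prop := Triangulation {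
  non_degenerate : forall c p q r,
    p \in vertices c -> q \in vertices c -> r \in vertices c ->
    p != q -> q != r -> p != r ->
    dot (perp (X q - X p)) (X r - X p) != 0;
  non_overlapping : forall c d, c != d ->
    (triangle c)° `&` (triangle d)° = set0;
  conforming : forall c d, c != d ->
    triangle c `&` triangle d = hull X (vertices c :&: vertices d);
  domain_connected : connected domain;
  two_boundary_edges : forall p, p \in boundary_nodes M ->
    #|boundary_edge p| = 2%N
}.

Definition centroid c : 'cV[R]_2 := 3^-1 *: \sum_(p in vertices c) X p.

(* Distance from p to the midpoint of the edge pq. *)
Definition half_length p q : R := enorm (2^-1 *: (X p + X q) - X p).

(* Unit normal to the edge pq of the cell c, pointing away from the centroid
   of c, i.e. outward. *)
Definition edge_normal c p q : 'cV[R]_2 :=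
  let e := X q - X p in
  (- Num.sg (dot (perp e) (centroid c - X p)) / enorm e) *: perp e.

(* For p in P(c), the two edges "+" and "-" of c at p are the edges pq with q
   in P(c) \ {p}. *)
Definition corner c p : 'cV[R]_2 :=
  \sum_(q in vertices c :\ p) half_length p q *: edge_normal c p q.

(* The outward normal of the domain on a boundary edge is that of the unique
   cell having this edge. *)
Definition boundary_corner p : 'cV[R]_2 :=
  \sum_(c in cells_at p) \sum_(q in vertices c :\ p | boundary_edge p q)
     half_length p q *: edge_normal c p q.

End Geometry.

Section Thermodynamics.
Variable R : realType.

(* Thermodynamic states are pairs (tau, S) with tau > 0. *)
Definition states : set (R * R) := [set z | 0 < z.1].

Definition d_tau (f : R * R -> R) : R * R -> R := fun z => 'D_(1, 0) f z.
Definition d_S (f : R * R -> R) : R * R -> R := fun z => 'D_(0, 1) f z.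

(* C^k on the open set [states]. *)
Fixpoint of_class (k : nat) (f : R * R -> R) : Prop :=
  match k with
  | 0%N => forall z, states z -> {for z, continuous f}
  | k'.+1 => [/\ forall z, states z -> differentiable f z,
                 of_class k' (d_tau f) & of_class k' (d_S f)]
  end.

Record eos := Eos {
  energy : R * R -> R;
  sound_speed : R * R -> R;
  energy_smooth : forall k, of_class k energy;
  energy_convex : @convex_function R (R^o * R^o)%type states energy;
  energy_tautau_gt0 : forall z, states z -> 0 < d_tau (d_tau energy) z;
  energy_S_gt0 : forall z, states z -> 0 < d_S energy z;
  sound_speed_gt0 : forall z, states z -> 0 < sound_speed z;
  sound_speedE : forall z, states z ->
    sound_speed z ^+ 2 / z.1 ^+ 2 = d_tau (d_tau energy) z
}.

Definition pressure (e : eos) (z : R * R) : R := - d_tau (energy e) z.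
Definition temperature (e : eos) (z : R * R) : R := d_S (energy e) z.

End Thermodynamics.

(* Quantities of the scheme at a fixed time: X and vs are the nodal positions
   and velocities, z c = (tau_c, S_c) and v c the cell unknowns. *)
Section Scheme.
Variables (R : realType) (M : mesh) (e : eos R).
Variables (X : node M -> 'cV[R]_2) (z : cell M -> R * R).
Implicit Types (c : cell M) (p : node M).

Definition corner_matrix c p : 'M[R]_2 :=
  (sound_speed e (z c) / (z c).1) *:
    \sum_(q in vertices c :\ p)
       half_length X p q *: tensor (edge_normal X c p q) (edge_normal X c p q).

Definition nodal_matrix p : 'M[R]_2 := \sum_(c in cells_at p) corner_matrix c p.

Variables (v : cell M -> 'cV[R]_2) (vs : node M -> 'cV[R]_2).

Definition nodal_solver : Prop := forall p,
  nodal_matrix p *m vs p =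
  \sum_(c in cells_at p)
     (pressure e (z c) *: corner X c p + corner_matrix c p *m v c).

(* The vector written l_pc n_pc p*_pc. *)
Definition subcell_force c p : 'cV[R]_2 :=
  pressure e (z c) *: corner X c p - corner_matrix c p *m (vs p - v c).

Definition entropy_production c p : R :=
  (temperature e (z c))^-1 *
  dot (v c - vs p) (corner_matrix c p *m (v c - vs p)).

Lemma entropy_production_ge0 c p : states (z c) -> 0 <= entropy_production c p.
Proof.
move=> zc; rewrite /entropy_production mulr_ge0//.
  by rewrite invr_ge0 ltW// energy_S_gt0.
set w := v c - vs p.
have dotE (a b : 'cV[R]_2) : dot a b = (a^T *m b) 0 0.
  by rewrite mxE; apply: eq_bigr => i _; rewrite mxE.
rewrite dotE /corner_matrix -scalemxAl -scalemxAr mxE mulr_ge0//.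
  by rewrite divr_ge0// ltW// sound_speed_gt0.
rewrite mulmx_suml mulmx_sumr summxE sumr_ge0// => q _.
rewrite -scalemxAl -scalemxAr mxE mulr_ge0 ?sqrtr_ge0//.
set n := edge_normal X c p q; rewrite /tensor -mulmxA (mulmxA w^T) mxE big_ord1.
by rewrite -!dotE (_ : dot w n = dot n w) ?sqr_ge0//;
   apply: eq_bigr => i _; rewrite mulrC.
Qed.

End Scheme.

(* A solution on the set of times J; time is the first argument. *)
Record scheme_solution (R : realType) (M : mesh) (e : eos R) (J : set R)
    (m : cell M -> R) (tau S : R -> cell M -> R) (v : R -> cell M -> 'cV[R]_2)
    (x vs : R -> node M -> 'cV[R]_2)
    (z := fun t c => (tau t c, S t c)) : Prop := SchemeSolution {
  volume_eq : forall t c, J t ->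
    derivable (tau ^~ c) t 1 /\
    m c * derive1 (tau ^~ c) t
      - \sum_(p in vertices c) dot (corner (x t) c p) (vs t p - v t c) = 0;
  momentum_eq : forall t c, J t ->
    derivable (v ^~ c) t 1 /\
    m c *: derive1 (v ^~ c) t
      + \sum_(p in vertices c)
          (subcell_force e (x t) (z t) (v t) (vs t) c p
             - pressure e (z t c) *: corner (x t) c p) = 0;
  entropy_eq : forall t c, J t ->
    derivable (S ^~ c) t 1 /\
    m c * derive1 (S ^~ c) t =
      \sum_(p in vertices c)
         entropy_production e (x t) (z t) (v t) (vs t) c p;
  node_motion : forall t p, J t ->
    derivable (x ^~ p) t 1 /\ derive1 (x ^~ p) t = vs t p;
  nodal_velocity : forall t, J t -> nodal_solver e (x t) (z t) (v t) (vs t)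
}.

Definition total_energy (R : realType) (e : eos R) (z : R * R)
    (v : 'cV[R]_2) : R := energy e z + 2^-1 * enorm v ^+ 2.

(* Main.v *)
Require Import Defs.
From HB Require Import structures.
From mathcomp Require Import all_boot all_order all_algebra.
From mathcomp Require Import all_classical all_reals all_analysis.
From mathcomp Require Import ring.

Set Implicit Arguments.
Unset Strict Implicit.
Unset Printing Implicit Defensive.

Import Order.TTheory GRing.Theory Num.Theory.
Import numFieldNormedType.Exports.

Local Open Scope classical_set_scope.
Local Open Scope ring_scope.

(** The Gibbs relation d(epsilon) = - p d(tau) + theta dS turns the time
    derivative of the energy of a cell c into

      m_c dE_c/dt = - p_c (m_c dtau_c/dt) + theta_c (m_c dS_c/dt)
                    + v_c . (m_c dv_c/dt),

    and the scheme replaces each bracket by a sum over the corners (c, p) of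
    the cell. Write C for the corner vector, K for the corner matrix,
    w = v*_p - v_c, and F = p_c C - K w for the sub-cell force. The corner p
    then contributes

      - p_c C . w + w . K w + v_c . K w = - v*_p . F + p_c v_c . C.

    The entropy production is precisely the term w . K w that completes the
    work v_c . K w of the viscous force on the cell into its work v*_p . K w on
    the node. The remainder p_c v_c . C vanishes after summation over p,
    because the corner vectors of a triangle add up to zero ([sum_corner]), so
    that each cell loses exactly the power its forces exert on its nodes
    ([cell_power]).

    It remains to sum over the cells and to regroup by nodes
    ([sum_force_power]): the linear system defining v*_p says that the forces
    around p are in equilibrium ([sum_subcell_force]). It has the same form at
    interior and boundary nodes, so every node contributes zero separately,
    and the total vanishes. *)

(** * The Euclidean plane *)

Section Dot.
Variable R : realType.
Implicit Types u v w : 'cV[R]_2.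

Lemma dotE u v : dot u v = u 0 0 * v 0 0 + u 1 0 * v 1 0.
Proof.
rewrite /dot big_ord_recl big_ord1.
by congr (_ + u _ _ * v _ _); apply: val_inj.
Qed.

Lemma dotC u v : dot u v = dot v u.
Proof. by rewrite !dotE; ring. Qed.

Lemma dotDr u v w : dot u (v + w) = dot u v + dot u w.
Proof. by rewrite !dotE !mxE; ring. Qed.

Lemma dotZr u a v : dot u (a *: v) = a * dot u v.
Proof. by rewrite !dotE !mxE; ring. Qed.

Lemma dotNr u v : dot u (- v) = - dot u v.
Proof. by rewrite !dotE !mxE; ring. Qed.

Lemma dot_sumr (I : finType) (A : {set I}) u (F : I -> 'cV[R]_2) :
  dot u (\sum_(i in A) F i) = \sum_(i in A) dot u (F i).
Proof.
apply: (big_morph (dot u)); first exact: dotDr.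
by rewrite !dotE !mxE !mulr0 addr0.
Qed.

Lemma enorm_sqr u : enorm u ^+ 2 = dot u u.
Proof.
rewrite sqr_sqrtr// dotE -!expr2.
by rewrite addr_ge0 ?sqr_ge0.
Qed.

Lemma enormZ a u : 0 <= a -> enorm (a *: u) = a * enorm u.
Proof.
move=> a0; rewrite /enorm dotZr dotC dotZr mulrA -expr2 sqrtrM ?sqr_ge0//.
by rewrite sqrtr_sqr ger0_norm.
Qed.

Lemma perp_enorm0 u : enorm u = 0 -> perp u = 0.
Proof.
move=> u0; have := enorm_sqr u; rewrite u0 expr0n dotE => /esym/eqP.
rewrite -!expr2 paddr_eq0 ?sqr_ge0// !sqrf_eq0 => /andP[/eqP a0 /eqP b0].
apply/colP => i; rewrite !mxE a0 b0 oppr0; by case: ifP.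
Qed.

End Dot.

(** * Closure of the corner vectors around a cell *)

Section Corner.
Variables (R : realType) (M : mesh) (X : node M -> 'cV[R]_2).

(** The length of the edge cancels: only its rotated direction and the side on
    which the centroid lies remain. This includes an edge reduced to a point,
    where both members vanish. *)
Lemma half_length_edge_normal c p q :
  half_length X p q *: edge_normal X c p q =
  - (Num.sg (dot (perp (X q - X p)) (centroid X c - X p)) / 2)
    *: perp (X q - X p).
Proof.
rewrite /half_length /edge_normal.
have -> : 2^-1 *: (X p + X q) - X p = 2^-1 *: (X q - X p).
  by apply/colP => i; rewrite !mxE; field.
rewrite enormZ ?invr_ge0// scalerA.
have [e0|e0] := eqVneq (enorm (X q - X p)) 0.
  by rewrite (perp_enorm0 e0) !scaler0.
by congr (_ *: _); field.
Qed.

Lemma sum_distinct_pairs (I : finType) (V : nmodType) (a b c : I)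
    (F : I -> I -> V) (A := [set a; b; c]%SET) :
  a != b -> b != c -> a != c ->
  \sum_(p in A) \sum_(q in A :\ p) F p q =
  (F a b + F a c) + (F b a + F b c) + (F c a + F c b).
Proof.
move=> ab bc ac; rewrite {1}/A.
have sum2 (G : I -> V) x y : x != y -> \sum_(i in [set x; y]%SET) G i = G x + G y.
  by move=> xy; rewrite big_setU1 ?inE//= big_set1.
have -> : [set a; b; c]%SET = (a |: [set b; c])%SET.
  by apply/setP => i; rewrite !inE orbA.
rewrite big_setU1 ?inE ?negb_or ?ab//= sum2// addrA.
have -> : (A :\ a = [set b; c])%SET.
  apply/setP => i; rewrite !inE.
  by case: (eqVneq i a) => [->|]//=; rewrite (negbTE ab) (negbTE ac).
have -> : (A :\ b = [set a; c])%SET.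
  apply/setP => i; rewrite !inE.
  by case: (eqVneq i b) => [->|]//=; rewrite ?orbF// eq_sym (negbTE ab) (negbTE bc).
have -> : (A :\ c = [set a; b])%SET.
  apply/setP => i; rewrite !inE.
  case: (eqVneq i c) => [->|]//=; rewrite ?orbF//.
  by rewrite eq_sym (negbTE ac) eq_sym (negbTE bc).
by rewrite !sum2.
Qed.

(** Each edge of the triangle is counted twice, once from each end, so the sum
    is that of the three outward normals weighted by the edge lengths. Along a
    cyclic enumeration of the vertices all three normals are the edge vectors
    rotated in the same sense, and the edge vectors of a closed polygon add up
    to zero. *)
Lemma sum_corner c : \sum_(p in vertices c) corner X c p = 0.
Proof.
have [s0 [s1 [s2 [n01 n12 n02 Vc]]]] : exists i j k,
    [/\ i != j, j != k, i != k & vertices c = [set i; j; k]%SET].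
  have := card_vertices c.
  have [[|i [|j [|k []]]]//=] := cards_eqP (vertices c).
  rewrite !inE !negb_or !andbT => /andP[/andP[ij ik] jk] _.
  by exists i, j, k; split=> //; apply/setP => l; rewrite !inE orbA.
rewrite /corner Vc sum_distinct_pairs//.
rewrite !half_length_edge_normal.
have -> : centroid X c = 3^-1 *: (X s0 + X s1 + X s2).
  rewrite /centroid Vc -finset.setUA big_setU1 ?inE ?negb_or ?n01//=.
  by rewrite big_setU1 ?inE//= big_set1 addrA.
set a := X s0; set b := X s1; set d := X s2.
(* D is twice the signed area; the side of the centroid relative to each edge
   of the cycle a, b, d is D / 3. *)
pose D := dot (perp (b - a)) (d - a).
have sgD : Num.sg (D / 3) = Num.sg D.
  by rewrite sgrM (@gtr0_sg _ 3^-1) ?mulr1// invr_gt0.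
(* Both orderings of an edge contribute the same vector, because reversing an
   edge changes the sign of its rotated direction and, with it, of the test
   for the side of the centroid. *)
have edge_pair (x y : 'cV[R]_2) :
    dot (perp (y - x)) (3^-1 *: (a + b + d) - x) = D / 3 ->
    - (Num.sg (dot (perp (y - x)) (3^-1 *: (a + b + d) - x)) / 2)
      *: perp (y - x) = - (Num.sg D / 2) *: perp (y - x) /\
    - (Num.sg (dot (perp (x - y)) (3^-1 *: (a + b + d) - y)) / 2)
      *: perp (x - y) = - (Num.sg D / 2) *: perp (y - x).
  move=> xy; split; first by rewrite xy sgD.
  have -> : dot (perp (x - y)) (3^-1 *: (a + b + d) - y) = - (D / 3).
    by rewrite -xy !dotE !mxE /=; ring.
  rewrite sgrN sgD.
  have -> : perp (x - y) = - perp (y - x).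
    by apply/colP => i; rewrite !mxE; case: ifP => _; ring.
  by rewrite mulNr scalerN !scaleNr !opprK.
have [|-> ->] := edge_pair a b; first by rewrite /D !dotE !mxE /=; field.
have [|-> ->] := edge_pair b d; first by rewrite /D !dotE !mxE /=; field.
have [|-> ->] := edge_pair d a; first by rewrite /D !dotE !mxE /=; field.
apply/colP => i; rewrite !mxE; case: ifP => _; ring.
Qed.

End Corner.

(** * Time derivative of the total energy of a cell *)

Lemma diff_plane (R : realType) (f : R * R -> R) z (a b : R) :
  'd f z (a, b) = a * 'd f z (1, 0) + b * 'd f z (0, 1).
Proof.
have <- : a *: (1, 0) + b *: (0, 1) = (a, b) :> (R * R)%type.
  congr pair => /=; first by rewrite scaler0 addr0 [LHS]mulr1.
  by rewrite scaler0 add0r [LHS]mulr1.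
by rewrite raddfD; congr (_ + _); exact: linearZ.
Qed.

Section EnergyRate.
Variables (R : realType) (e : eos R).

(** The Gibbs relation along a differentiable path of states. *)
Lemma is_derive_eos (tau S : R -> R) (t dtau dS : R) :
  0 < tau t -> is_derive t 1 tau dtau -> is_derive t 1 S dS ->
  is_derive t 1 (fun s => energy e (tau s, S s))
    (- pressure e (tau t, S t) * dtau + temperature e (tau t, S t) * dS).
Proof.
move=> tau0 dtauP dSP.
have [dfe _ _] := energy_smooth e 1.
have {}dfe := dfe (tau t, S t) tau0.
have /derivable1_diffP dft : derivable tau t 1 by [].
have /derivable1_diffP dfS : derivable S t 1 by [].
pose g s := (tau s, S s).
have dfg : differentiable g t by exact: differentiable_pair.
have dfeg : differentiable (energy e \o g) t by exact: differentiable_comp.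
apply: DeriveDef; first exact/derivable1_diffP.
rewrite deriveE// (diff_comp dfg dfe)/= (diff_pair dft dfS).
rewrite /pressure /temperature opprK /d_tau /d_S !deriveE//.
by rewrite diff_plane -!deriveE// !derive_val mulrC [dS * _]mulrC.
Qed.

Lemma is_derive_coord (m n : nat) (A : R -> 'M[R]_(m, n)) (t : R) dA i j :
  is_derive t 1 A dA -> is_derive t 1 (fun s => A s i j) (dA i j).
Proof.
move=> dAP; have /derivable1_diffP dfA : derivable A t 1 by [].
have dfc := @differentiable_coord R m n (A t) i j.
have dfcA : differentiable ((fun N : 'M[R]_(m, n) => N i j) \o A) t.
  exact: differentiable_comp.
apply: DeriveDef; first exact/derivable1_diffP.
rewrite deriveE// (diff_comp dfA dfc)/=.
have -> : 'd A t 1 = dA by rewrite -deriveE// derive_val.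
pose coord (N : 'M[R]_(m, n)) : R := N i j.
have coord_lin : linear coord by move=> k N P; rewrite /coord !mxE.
pose coordM := GRing.isLinear.Build _ _ _ _ _ coord_lin.
pose coordL : {linear 'M[R]_(m, n) -> R} := HB.pack coord coordM.
have coord_cont : continuous coordL by exact: coord_continuous.
by have /(congr1 (fun f => f dA)) := diff_lin (A t) coord_cont.
Qed.

Lemma is_derive_kinetic (v : R -> 'cV[R]_2) (t : R) dv :
  is_derive t 1 v dv ->
  is_derive t 1 (fun s => 2^-1 * enorm (v s) ^+ 2) (dot (v t) dv).
Proof.
move=> dvP.
have dsq (i : 'I_2) :
    is_derive t 1 (fun s => v s i 0 ^+ 2) (2 * v t i 0 * dv i 0).
  exact: is_derive_eq (is_deriveX 2 (is_derive_coord i 0 dvP)) _.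
have dsum := is_deriveZ 2^-1 (is_deriveD (dsq 0) (dsq 1)).
have -> : (fun s => 2^-1 * enorm (v s) ^+ 2) =
    2^-1 *: ((fun s => v s 0 0 ^+ 2) + (fun s => v s 1 0 ^+ 2)).
  by apply/funext => s; rewrite enorm_sqr dotE -!expr2.
apply: is_derive_eq; rewrite dotE.
(* Scaling of the reals by themselves has to be read as multiplication. *)
rewrite -[LHS]/(2^-1 * (2 * v t 0 0 * dv 0 0 + 2 * v t 1 0 * dv 1 0)).
by field.
Qed.

End EnergyRate.

(** * Discrete power balance *)

Section Balance.
Variables (R : realType) (M : mesh) (e : eos R).
Variables (X : node M -> 'cV[R]_2) (z : cell M -> R * R).
Variables (v : cell M -> 'cV[R]_2) (vs : node M -> 'cV[R]_2).
Local Notation force := (subcell_force e X z v vs).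

(** Force balance at a node: the linear system for the nodal velocity,
    rearranged. *)
Lemma sum_subcell_force p : nodal_solver e X z v vs ->
  \sum_(c in cells_at p) force c p = 0.
Proof.
move=> /(_ p); rewrite /nodal_matrix mulmx_suml => /eqP.
rewrite eq_sym -subr_eq0 -sumrB => /eqP solv.
apply: etrans solv; apply: eq_bigr => c _.
by rewrite /subcell_force mulmxBr opprB addrA.
Qed.

Lemma sum_force_power : nodal_solver e X z v vs ->
  \sum_c \sum_(p in vertices c) dot (vs p) (force c p) = 0.
Proof.
move=> solv; rewrite (exchange_big_dep xpredT)//= big1// => p _.
transitivity (dot (vs p) (\sum_(c in cells_at p) force c p)).
  by rewrite dot_sumr; apply: eq_bigl => c; rewrite inE.
by rewrite sum_subcell_force// -(scale0r 0) dotZr mul0r.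
Qed.

(** The left-hand side is the energy rate of the cell once the scheme has been
    substituted in it. Corner by corner, pressure work, heat and viscous work
    combine into the power of the sub-cell force at the nodal velocity, up to
    terms proportional to the corner vectors, whose sum is zero. *)
Lemma cell_power c : temperature e (z c) != 0 ->
  - pressure e (z c) * \sum_(p in vertices c) dot (corner X c p) (vs p - v c)
  + temperature e (z c) *
      \sum_(p in vertices c) entropy_production e X z v vs c p
  - dot (v c) (\sum_(p in vertices c)
       (force c p - pressure e (z c) *: corner X c p))
  = - \sum_(p in vertices c) dot (vs p) (force c p).
Proof.
move=> th0.
suff : \sum_(p in vertices c)
    (- pressure e (z c) * dot (corner X c p) (vs p - v c)
     + temperature e (z c) * entropy_production e X z v vs c p
     - dot (v c) (force c p - pressure e (z c) *: corner X c p)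
     + dot (vs p) (force c p)) = 0.
  move=> /eqP; rewrite 3!big_split/= sumrN -!mulr_sumr -dot_sumr addr_eq0.
  by move=> /eqP.
transitivity
  (\sum_(p in vertices c) pressure e (z c) * dot (v c) (corner X c p)).
  apply: eq_bigr => p _; rewrite /entropy_production mulVKf//.
  rewrite /subcell_force -(opprB (vs p) (v c)) mulmxN dotNr.
  set C := corner X c p; set F := corner_matrix _ _ _ _ _ *m _.
  by rewrite !dotE !mxE; ring.
by rewrite -mulr_sumr -dot_sumr sum_corner -(scale0r 0) dotZr mul0r mulr0.
Qed.

End Balance.

Unset Implicit Arguments.

Theorem theorem3p2 (R : realType) (M : mesh) (e : eos R) (J : set R)
    (m : cell M -> R) (tau S : R -> cell M -> R) (v : R -> cell M -> 'cV[R]_2)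
    (x vs : R -> node M -> 'cV[R]_2) :
  open J -> is_interval J ->
  (forall t, J t -> triangulation (x t)) ->
  (forall t c, J t -> 0 < tau t c) ->
  (forall c, 0 < m c) ->
  (forall t c, J t -> m c = area (triangle (x t) c) / tau t c) ->
  (forall t, J t ->
     \sum_(p in boundary_nodes M) dot (vs t p) (boundary_corner (x t) p) = 0) ->
  scheme_solution e J m tau S v x vs ->
  forall t, J t ->
    let E c s := total_energy e (tau s c, S s c) (v s c) in
    (forall c, derivable (E c) t 1) /\
    \sum_(c : cell M) m c * derive1 (E c) t = 0.
Proof.
move=> _ _ _ tau_gt0 _ _ _ sol t Jt E.
pose z c := (tau t c, S t c).
have tauP c : is_derive t 1 (tau ^~ c) (derive1 (tau ^~ c) t).
  by rewrite derive1E; apply/derivableP; have [] := volume_eq sol c Jt.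
have SP c : is_derive t 1 (S ^~ c) (derive1 (S ^~ c) t).
  by rewrite derive1E; apply/derivableP; have [] := entropy_eq sol c Jt.
have vP c : is_derive t 1 (v ^~ c) (derive1 (v ^~ c) t).
  by rewrite derive1E; apply/derivableP; have [] := momentum_eq sol c Jt.
have EP c : is_derive t 1 (E c)
    (- pressure e (z c) * derive1 (tau ^~ c) t
     + temperature e (z c) * derive1 (S ^~ c) t
     + dot (v t c) (derive1 (v ^~ c) t)).
  apply: is_deriveD; last exact: is_derive_kinetic.
  by apply: is_derive_eos => //; exact: tau_gt0.
split=> [c|]; first by have [] := EP c.
transitivity (- \sum_c \sum_(p in vertices c)
    dot (vs t p) (subcell_force e (x t) z (v t) (vs t) c p)).
  rewrite -sumrN; apply: eq_bigr => c _.
  have th0 : temperature e (z c) != 0.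
    by rewrite gt_eqF// energy_S_gt0//; exact: tau_gt0.
  rewrite -cell_power//.
  have [_ /eqP] := volume_eq sol c Jt; rewrite subr_eq0 => /eqP <-.
  have [_ <-] := entropy_eq sol c Jt.
  have [_ /eqP] := momentum_eq sol c Jt; rewrite addrC addr_eq0 => /eqP ->.
  rewrite derive1E derive_val dotNr dotZr; ring.
by rewrite (sum_force_power (nodal_velocity sol Jt)) oppr0.
Qed.
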